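(* Let $T$ be a complete countable first-order theory in a language $\mathcal{L}$ and $\mathcal{B}$ a complete Boolean algebra. Then: (1) (Downward Löwenheim–Skolem) If $\mathbf{M}\models^{\mathcal{B}}T$ and $X\subseteq\mathbf{M}$, there is a full $\mathbf{N}\preceq\mathbf{M}$ with $X\subseteq\mathbf{N}$ and $|\mathbf{N}|\le|X|+\aleph_0$. (2) (Joint embedding) If $\mathbf{M}_0,\mathbf{M}_1\models^{\mathcal{B}}T$, there are $\mathbf{N}\models^{\mathcal{B}}T$ and elementary maps $f_i:\mathbf{M}_i\preceq\mathbf{N}$ for $i<2$. (3) (Amalgamation) If $\mathbf{M},\mathbf{M}_0,\mathbf{M}_1\models^{\mathcal{B}}T$ with $\mathbf{M}\preceq\mathbf{M}_0$ and $\mathbf{M}\preceq\mathbf{M}_1$, there are $\mathbf{N}\models^{\mathcal{B}}T$ and elementary maps $f_i:\mathbf{M}_i\preceq\mathbf{N}$ ($i<2$) such that $f_0$ and $f_1$ agree on $\mathbf{M}$.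
   Context: $\mathcal{L}(X)$ is the set of $\mathcal{L}$-formulas with parameters from $X$. A $\mathcal{B}$-valued $\mathcal{L}$-structure is a set $\mathbf{M}$ with a map $\|\cdot\|_{\mathbf{M}}:\mathcal{L}(\mathbf{M})\to\mathcal{B}$ such that logically valid sentences have value $1$, $\|\neg\varphi\|=\neg\|\varphi\|$, $\|\varphi\wedge\psi\|=\|\varphi\|\wedge\|\psi\|$, $\|\exists x\varphi(x)\|=\bigvee_{a\in\mathbf{M}}\|\varphi(a)\|$, and $\|a=b\|<1$ for distinct $a,b$; it is full if for each $\varphi(x)$ with parameters from $\mathbf{M}$ some $a\in\mathbf{M}$ has $\|\exists x\varphi(x)\|=\|\varphi(a)\|$. $\mathbf{M}\models^{\mathcal{B}}T$ means $\mathbf{M}$ is a full $\mathcal{B}$-valued $\mathcal{L}$-structure with $\|\varphi\|_{\mathbf{M}}=1$ for all $\varphi\in T$. For $\mathcal{B}$-valued structures $\mathbf{M},\mathbf{N}$, $f:\mathbf{M}\preceq\mathbf{N}$ (an elementary map) means $f:\mathbf{M}\to\mathbf{N}$ and $\|\varphi(\overline{a})\|_{\mathbf{M}}=\|\varphi(f(\overline{a}))\|_{\mathbf{N}}$ for all $\varphi(\overline{a})\in\mathcal{L}(\mathbf{M})$; $\mathbf{M}\preceq\mathbf{N}$ means $\mathbf{M}\subseteq\mathbf{N}$ and the inclusion is elementary. *)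

(* Defs.v *)
From mathcomp Require Import all_boot all_order.
From mathcomp Require Import boolp classical_sets functions.

Set Implicit Arguments.
Unset Strict Implicit.
Unset Printing Implicit Defensive.

Local Open Scope classical_set_scope.

Record language : Type := Language {
  fsym : Type;
  farity : fsym -> nat;
  rsym : Type;
  rarity : rsym -> nat }.

Inductive term (L : language) (V : Type) : Type :=
| Var of V
| Fun (f : fsym L) of ('I_(farity f) -> term L V).

(* [formula L V] is the type of L-formulas whose free names range over V; Ex
   binds the name None.  Free names serve both as parameters and as free
   variables: L(X) is [formula L X], the formulas phi(x) with parameters in X
   are [formula L (option X)], and the parameter-free sentences are
   [formula L void]. *)
Inductive formula (L : language) (V : Type) : Type :=
| Eq of term L V & term L V
| Rel (r : rsym L) of ('I_(rarity r) -> term L V)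
| Neg of formula L V
| And of formula L V & formula L V
| Ex of formula L (option V).

Arguments Var {L V} _.
Arguments Fun {L V} _ _.
Arguments Eq {L V} _ _.
Arguments Rel {L V} _ _.
Arguments Neg {L V} _.
Arguments And {L V} _ _.
Arguments Ex {L V} _.

Fixpoint tmap (L : language) (V W : Type) (s : V -> W) (t : term L V) :
    term L W :=
  match t with
  | Var v => Var (s v)
  | Fun f ts => Fun f (fun i => tmap s (ts i))
  end.

Fixpoint fmap (L : language) (V W : Type) (s : V -> W) (phi : formula L V) :
    formula L W :=
  match phi with
  | Eq t u => Eq (tmap s t) (tmap s u)
  | Rel r ts => Rel r (fun i => tmap s (ts i))
  | Neg p => Neg (fmap s p)
  | And p q => And (fmap s p) (fmap s q)
  | Ex p => Ex (fmap (omap s) p)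
  end.

(* phi(a) *)
Definition inst (L : language) (V : Type) (phi : formula L (option V)) (a : V) :
    formula L V :=
  fmap (odflt a) phi.

Record structure (L : language) : Type := Structure {
  dom :> Type;
  dom_nonempty : inhabited dom;
  fint : forall f : fsym L, ('I_(farity f) -> dom) -> dom;
  rint : forall r : rsym L, ('I_(rarity r) -> dom) -> Prop }.

Fixpoint teval (L : language) (S : structure L) (V : Type) (e : V -> S)
    (t : term L V) : S :=
  match t with
  | Var v => e v
  | Fun f ts => fint (fun i => teval e (ts i))
  end.

Fixpoint sat (L : language) (S : structure L) (V : Type) (e : V -> S)
    (phi : formula L V) : Prop :=
  match phi with
  | Eq t u => teval e t = teval e u
  | Rel r ts => rint (fun i => teval e (ts i))
  | Neg p => ~ sat e p
  | And p q => sat e p /\ sat e q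
  | Ex p => exists a : S, sat (fun o => if o is Some v then e v else a) p
  end.

Definition valid (L : language) (V : Type) (phi : formula L V) : Prop :=
  forall (S : structure L) (e : V -> S), sat e phi.

Definition sentence (L : language) : Type := formula L void.

Definition holds (L : language) (S : structure L) (phi : sentence L) : Prop :=
  sat (of_void S) phi.

Definition is_model (L : language) (T : set (sentence L)) (S : structure L) :
    Prop :=
  forall phi, T phi -> holds S phi.

Definition entails (L : language) (T : set (sentence L)) (phi : sentence L) :
    Prop :=
  forall S : structure L, is_model T S -> holds S phi.

Definition complete_theory (L : language) (T : set (sentence L)) : Prop :=
  (exists S : structure L, is_model T S) /\
  (forall phi : sentence L, entails T phi \/ entails T (Neg phi)).

(* A complete Boolean algebra is a [ctbDistrLatticeType] satisfying this. *)
Definition order_complete (d : Order.disp_t) (B : porderType d) : Prop :=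
  forall A : set B, exists b : B, supremums A b.

Record bvstructure (L : language) (d : Order.disp_t)
    (B : ctbDistrLatticeType d) (M : Type) : Type := BVStructure {
  bval :> formula L M -> B;
  bval_valid : forall phi, valid phi -> bval phi = Order.top;
  bval_neg : forall phi, bval (Neg phi) = Order.compl (bval phi);
  bval_and : forall phi psi,
    bval (And phi psi) = Order.meet (bval phi) (bval psi);
  bval_ex : forall phi : formula L (option M),
    supremums (range (fun a : M => bval (inst phi a))) (bval (Ex phi));
  bval_eq : forall a b : M,
    a <> b -> (bval (Eq (Var a) (Var b)) < Order.top)%O }.

Definition full (L : language) (d : Order.disp_t) (B : ctbDistrLatticeType d)
    (M : Type) (v : bvstructure L B M) : Prop :=
  forall phi : formula L (option M), exists a : M, v (Ex phi) = v (inst phi a).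

Definition bvmodels (L : language) (d : Order.disp_t)
    (B : ctbDistrLatticeType d) (M : Type) (v : bvstructure L B M)
    (T : set (sentence L)) : Prop :=
  full v /\ forall phi, T phi -> v (fmap (of_void M) phi) = Order.top.

Definition elementary (L : language) (d : Order.disp_t)
    (B : ctbDistrLatticeType d) (M N : Type) (v : bvstructure L B M)
    (w : bvstructure L B N) (f : M -> N) : Prop :=
  forall phi : formula L M, v phi = w (fmap f phi).

Definition inclusion (U : Type) (M N : set U) (MN : M `<=` N) (a : M) : N :=
  exist (fun x => x \in N) (val a) (mem_set (MN _ (set_mem (valP a)))).

Definition elementary_sub (L : language) (d : Order.disp_t)
    (B : ctbDistrLatticeType d) (U : Type) (M N : set U)
    (v : bvstructure L B M) (w : bvstructure L B N) : Prop :=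
  exists MN : M `<=` N, elementary v w (inclusion MN).

(* Main.v *)
(* Joint embedding is amalgamation over the empty set, so the core is amalgamation
   of M0 and M1 over V.  Assign to each formula over M0 or M1 its value in B.  If
   c <= v0 phi0 and c <= v1 phi1 with c <> 0, then phi0 /\ phi1 is satisfiable in
   some two-valued structure: the existential closure over V of phi1 has v1-value,
   hence v0-value, at least c, so phi0 conjoined with it is not refutable.  As B is
   complete, a Zorn argument a la Sikorski extends the assignment to a B-valued
   homomorphism on the formulas over M0, M1 and Henkin constants; identifying the
   constants equal with value 1 gives N, which is full thanks to the Henkin
   constants.

   For joint embedding one also needs that consequences of T have value 1 in full
   models of T; this is Los's theorem for quotients by ultrafilters of B.

   The Lowenheim-Skolem part takes a Skolem hull.  The language is not assumed
   countable, but completeness and countability of T make it so, unless T forces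
   all elements to be equal; in that case M itself is a singleton. *)

Require Import Defs.
From mathcomp Require Import all_boot all_order.
From mathcomp Require Import boolp classical_sets functions cardinality.

Set Implicit Arguments.
Unset Strict Implicit.
Unset Printing Implicit Defensive.

Import Order.Theory.

Local Open Scope classical_set_scope.
Local Open Scope card_scope.

(** * Syntax and finite support *)

Section Syntax.
Context {L : language}.

Lemma tmap_comp (V W Z : Type) (s : W -> Z) (r : V -> W) (t : term L V) :
  tmap s (tmap r t) = tmap (s \o r) t.
Proof.
by elim: t => [//|f ts IH] /=; congr Defs.Fun; apply/funext => i; exact: IH.
Qed.

Lemma compose_omap (V W Z : Type) (s : W -> Z) (r : V -> W) :
  omap s \o omap r = omap (s \o r).
Proof. by apply/funext; case. Qed.

Lemma fmap_comp (V W Z : Type) (s : W -> Z) (r : V -> W) (phi : formula L V) :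
  fmap s (fmap r phi) = fmap (s \o r) phi.
Proof.
elim: phi W Z s r => {V} [V t u|V r ts|V p IH|V p IHp q IHq|V p IH] W Z s r' /=.
- by rewrite !tmap_comp.
- by congr Rel; apply/funext => i; rewrite tmap_comp.
- by rewrite IH.
- by rewrite IHp IHq.
- by rewrite IH compose_omap.
Qed.

Lemma tmap_id (V : Type) (t : term L V) : tmap id t = t.
Proof.
by elim: t => [//|f ts IH] /=; congr Defs.Fun; apply/funext => i; exact: IH.
Qed.

Lemma fmap_id (V : Type) (phi : formula L V) : fmap id phi = phi.
Proof.
elim: phi => {V} [V t u|V r ts|V p IH|V p IHp q IHq|V p IH] /=.
- by rewrite !tmap_id.
- by congr Rel; apply/funext => i; rewrite tmap_id.
- by rewrite IH.
- by rewrite IHp IHq.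
- suff -> : omap (@id V) = id by rewrite IH.
  by apply/funext; case.
Qed.

Definition ext {S V : Type} (e : V -> S) (a : S) : option V -> S :=
  fun o => if o is Some v then e v else a.

Lemma ext_omap (S V W : Type) (e : W -> S) (s : V -> W) (a : S) :
  ext e a \o omap s = ext (e \o s) a.
Proof. by apply/funext; case. Qed.

Lemma teval_tmap (S : structure L) (V W : Type) (e : W -> S) (s : V -> W)
  (t : term L V) : teval e (tmap s t) = teval (e \o s) t.
Proof.
by elim: t => [//|f ts IH] /=; congr fint; apply/funext => i; exact: IH.
Qed.

Lemma sat_fmap (S : structure L) (V W : Type) (e : W -> S) (s : V -> W)
  (phi : formula L V) : sat e (fmap s phi) = sat (e \o s) phi.
Proof.
elim: phi W e s => {V} [V t u|V r ts|V p IH|V p IHp q IHq|V p IH] W e s /=.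
- by rewrite !teval_tmap.
- by congr rint; apply/funext => i; rewrite teval_tmap.
- by rewrite IH.
- by rewrite IHp IHq.
- by congr ex; apply/funext => a; rewrite IH -[fun o => _]/(ext e a) ext_omap.
Qed.

Lemma sat_inst (S : structure L) (V : Type) (e : V -> S)
  (phi : formula L (option V)) (a : V) :
  sat e (inst phi a) = sat (ext e (e a)) phi.
Proof. by rewrite sat_fmap; congr sat; apply/funext; case. Qed.

Lemma sat_ex (S : structure L) (V : Type) (e : V -> S)
  (phi : formula L (option V)) :
  sat e (Ex phi) <-> exists a, sat (ext e a) phi.
Proof. by []. Qed.

Lemma sat_and (S : structure L) (V : Type) (e : V -> S) (phi psi : formula L V) :
  sat e (And phi psi) <-> sat e phi /\ sat e psi.
Proof. by []. Qed.

Lemma mem_flatten_enum (n : nat) (V : eqType) (s : 'I_n -> seq V) (i : 'I_n)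
  (x : V) : x \in s i -> x \in flatten [seq s j | j <- enum 'I_n].
Proof.
by move=> xi; apply/flattenP; exists (s i) => //; rewrite map_f// mem_enum.
Qed.

Lemma mem_pmap_id (V : Type) (s : seq {classic option V}) (x : V) :
  (Some x : {classic option V}) \in s ->
  (x : {classic V}) \in (pmap id s : seq {classic V}).
Proof.
elim: s => //= -[y|] s IH /=; rewrite !inE => /predU1P[|/IH]//.
- by case=> ->; rewrite eqxx.
- by move=> ->; rewrite orbT.
Qed.

(** Support is taken semantically, as a finite list outside which assignments may differ. The type
    [{classic V}] equips arbitrary names with the equality test that list membership requires. *)
Lemma teval_support (V : Type) (t : term L V) :
  exists s : seq {classic V}, forall (S : structure L) (e e' : V -> S),
    {in s, e =1 e'} -> teval e t = teval e' t.
Proof.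
elim: t => [v|f ts /choice[s sP]].
  by exists [:: (v : {classic V})] => S e e' ee' /=; apply: ee'; rewrite inE.
exists (flatten [seq s i | i <- enum 'I_(farity f)]) => S e e' ee' /=.
congr fint; apply/funext => i; apply: sP => x xi.
by apply: ee'; apply: mem_flatten_enum xi.
Qed.

Lemma sat_support (V : Type) (phi : formula L V) :
  exists s : seq {classic V}, forall (S : structure L) (e e' : V -> S),
    {in s, e =1 e'} -> sat e phi = sat e' phi.
Proof.
elim: phi => {V} [V t u|V r ts|V p [s sP]|V p [s sP] q [s' s'P]|V p [s sP]].
- have [s sP] := teval_support t; have [s' s'P] := teval_support u.
  exists (s ++ s') => S e e' ee' /=.
  by rewrite (sP S e e') ?(s'P S e e')// => x xs; apply: ee';
    rewrite mem_cat xs ?orbT.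
- have /choice[s sP] := fun i => teval_support (ts i).
  exists (flatten [seq s i | i <- enum 'I_(rarity r)]) => S e e' ee' /=.
  congr rint; apply/funext => i; apply: sP => x xi.
  by apply: ee'; apply: mem_flatten_enum xi.
- by exists s => S e e' ee' /=; rewrite (sP S e e').
- exists (s ++ s') => S e e' ee' /=.
  by rewrite (sP S e e') ?(s'P S e e')// => x xs; apply: ee';
    rewrite mem_cat xs ?orbT.
- exists (pmap id s) => S e e' ee' /=; congr ex; apply/funext => a.
  by apply: sP => -[x|]//= xs; apply: ee'; exact: mem_pmap_id xs.
Qed.

(* Only finitely many parameters matter, so up to semantic equivalence every
   formula arises from one of the set [formula L (option nat)], which does not
   depend on the parameters. *)
Lemma formula_factor (V : Type) (v0 : V) (phi : formula L (option V)) :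
  exists (psi : formula L (option nat)) (s : seq V),
    forall (S : structure L) (e : V -> S) (x : S),
      sat (ext e x) phi = sat (ext (e \o nth v0 s) x) psi.
Proof.
have [s sP] := sat_support phi; pose s1 : seq {classic V} := pmap id s.
(* Names outside the support are sent to [size s1], which cannot affect the truth value. *)
exists (fmap (omap (fun x : V => index (x : {classic V}) s1)) phi), s1 => S e x.
rewrite sat_fmap ext_omap; apply: sP => -[v|]//= xs; have vs := mem_pmap_id xs.
by rewrite (nth_index (v0 : {classic V}) vs).
Qed.

(** By finite support, finitely many quantifiers bind all relevant names outside the range of [g].
    The induction runs over a list [l] of support names still to be treated and enlarges the range
    of [h] by one new name at a time. *)
Lemma ex_closure (V W : Type) (g : V -> W) (phi : formula L W) :
  injective g ->
  exists psi : formula L V, forall (S : structure L) (e : V -> S),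
    sat e psi <-> exists e' : W -> S, e' \o g = e /\ sat e' phi.
Proof.
have [s sP] := sat_support phi.
suff H (l : seq {classic W}) (X : Type) (h : X -> W) : injective h ->
  {in s, forall x : W, (x : {classic W}) \in l \/ exists y, h y = x} ->
  exists psi : formula L X, forall (S : structure L) (e : X -> S),
      sat e psi <-> exists e' : W -> S, e' \o h = e /\ sat e' phi.
  by move=> /(H s); apply=> x xs; left.
elim: l X h => [|w l IH] X h h_inj sl.
  (* The whole support now lies in the range of [h]. Since [X] may be empty, other names go to the
     dummy [None], bound by an outer [Ex]. *)
  have /choice[k kP] : forall w : W, exists o : option X,
      forall x, h x = w -> o = Some x.
    move=> w; have [[x <-]|nx] := pselect (exists x, h x = w).
      by exists (Some x) => y /h_inj ->.
    by exists None => x hx; case: nx; exists x.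
  exists (Ex (fmap k phi)) => S e; split.
    move=> /sat_ex[a]; rewrite sat_fmap => sa.
    exists (ext e a \o k); split => //.
    by apply/funext => x /=; rewrite (kP _ x).
  move=> [e' [<- se']]; have [a] := dom_nonempty S.
  apply/sat_ex; exists a; rewrite sat_fmap (sP _ _ e')// => x /sl[//|[y <-]] /=.
  by rewrite (kP _ y).
have [[x0 hx0]|nw] := pselect (exists x, h x = w).
  apply: IH => // x /sl[|]; last by right.
  by rewrite inE => /predU1P[->|]; [right; exists x0|left].
have hw_inj : injective (ext h w).
  move=> [x|] [y|]//= => [/h_inj->//|hx|hx]; case: nw.
  - by exists x.
  - by exists y.
have [|psi psiP] := IH _ _ hw_inj.
  move=> x /sl[|[y <-]]; last by right; exists (Some y).
  by rewrite inE => /predU1P[->|]; [right; exists None|left].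
exists (Ex psi) => S e; rewrite sat_ex; split.
  move=> [a /psiP[e' [e'h se']]]; exists e'; split => //.
  by apply/funext => x; have := congr1 (fun f => f (Some x)) e'h.
move=> [e' [e'h se']]; exists (e' w); apply/psiP; exists e'; split => //.
by apply/funext => -[x|]//=; rewrite -e'h.
Qed.

End Syntax.

(** * Extension of homomorphisms into a complete Boolean algebra *)

Section Extension.
Local Open Scope order_scope.
Context {d : Order.disp_t} {B : ctbDistrLatticeType d}.
Hypothesis B_complete : order_complete B.
Context {F : eqType} (neg : F -> F) (con : seq F -> Prop).
Hypothesis con_sub : forall s s', {subset s <= s'} -> con s' -> con s.
Hypothesis con_split : forall s phi, con s -> con (phi :: s) \/ con (neg phi :: s).
Hypothesis con_neg : forall phi, ~ con [:: phi; neg phi].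

(* [G (phi, b)] stands for the requirement [b <= H phi] on a homomorphism H. *)
Definition at_level (G : set (F * B)) (c : B) (phi : F) :=
  exists2 b, G (phi, b) & c <= b.

Definition consistent (G : set (F * B)) := forall (c : B) (s : seq F),
  c != \bot -> {in s, forall phi, at_level G c phi} -> con s.

(* Sikorski's extension theorem without Boolean algebras on the source side:
   F with [con] plays the role of a Lindenbaum algebra.  A maximal consistent G
   is taken, and H phi is the supremum of the b with G (phi, b). *)
Lemma hom_extension (G0 : set (F * B)) : consistent G0 ->
  exists H : F -> B, [/\ forall phi b, G0 (phi, b) -> b <= H phi,
    forall phi, H (neg phi) = ~` H phi &
    forall s phi c, ~ con (neg phi :: s) ->
      {in s, forall psi, c <= H psi} -> c <= H phi].
Proof.
move=> G0_con.
(* Zorn is applied to what is added to [G0], so that the empty chain is also covered. In a nonempty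
   chain, a finite list uses requirements from a single member. *)
have [|A [A_con A_max]] := @Zorn_bigcup _ [set G | consistent (G0 `|` G)%classic].
  move=> Ch Ch_con Ch_tot c s c0 sP.
  have [Ch0|/set0P[X0 ChX0]] := eqVneq Ch set0.
    by apply: G0_con c0 _ => phi /sP[b [Gb|[X]]]; [exists b|rewrite Ch0].
  suff [X ChX XP] : exists2 X, Ch X & {in s, forall phi, at_level (G0 `|` X) c phi}.
    exact: Ch_con ChX c s c0 XP.
  elim: s sP => [|phi s IH] sP; first by exists X0.
  have [|X ChX XP] := IH; first by move=> psi ps; apply: sP; rewrite inE ps orbT.
  have [b [Gb|[Y ChY Yb]] cb] := sP phi (mem_head _ _).
    exists X => // psi; rewrite inE => /predU1P[->|/XP//].
    by exists b => //; left.
  have [XY|YX] := Ch_tot _ _ ChX ChY.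
    exists Y => // psi; rewrite inE => /predU1P[->|/XP].
      by exists b => //; right.
    by move=> [b' [?|/XY ?] cb']; exists b' => //; [left|right].
  exists X => // psi; rewrite inE => /predU1P[->|/XP//].
  by exists b => //; right; apply: YX.
pose G := (G0 `|` A)%classic.
(* By maximality, [(phi, b)] belongs to [G] once [phi] is compatible with [G] at every nonzero level
   below [b]; a level not below [b] does not see the new pair. *)
have G_max phi b : (forall c s, c != \bot -> c <= b ->
    {in s, forall psi, at_level G c psi} -> con (phi :: s)) -> G (phi, b).
  move=> add; apply: contrapT => nG.
  apply: (A_max (A `|` [set (phi, b)])%classic).
    split; last by move=> /(_ (phi, b)) AG; apply: nG; right; apply: AG; right.
    by move=> x Ax; left.
  move=> c s c0 sP.
  have sG : {in filter (predC1 phi) s, forall psi, at_level G c psi}.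
    move=> psi; rewrite mem_filter => /andP[/= /eqP np /sP[b' G' cb']].
    case: G' => [?|[?|[]//]]; exists b' => //; [by left|by right].
  have [cb|ncb] := boolP (c <= b).
    apply: con_sub (add c _ c0 cb sG) => psi ps.
    by rewrite inE mem_filter ps andbT; case: eqVneq.
  apply: A_con c0 _ => psi /sP[b' G' cb'].
  case: G' => [?|[?|[_ eb]]]; [by exists b' => //; left|by exists b' => //; right|].
  by move: ncb; rewrite -eb cb'.
have G_entail s phi c : ~ con (neg phi :: s) ->
    {in s, forall psi, at_level G c psi} -> G (phi, c).
  move=> ncon sG; apply: G_max => c' s' c0 c'c s'G.
  have : con (s ++ s').
    apply: A_con c0 _ => psi; rewrite mem_cat => /orP[/sG|/s'G//].
    by move=> [b Gb cb]; exists b => //; apply: le_trans cb.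
  move=> /(con_split phi)[|C].
    apply: con_sub => psi; rewrite !inE mem_cat.
    by move=> /orP[->//|->]; rewrite !orbT.
  exfalso; apply: ncon; apply: con_sub C => psi; rewrite !inE mem_cat.
  by move=> /orP[->//|->]; rewrite !orbT.
have /choice[H HP] := fun phi => B_complete [set b | G (phi, b)]%classic.
have H_ub phi b : G (phi, b) -> b <= H phi.
  by move=> Gb; case: (HP phi) => + _; apply.
have H_lub phi b : (forall c, G (phi, c) -> c <= b) -> H phi <= b.
  by move=> bP; case: (HP phi) => _; apply.
(* The supremum is attained: a nonzero [c] below [H phi] meets some [b] with [G (phi, b)], as
   otherwise [H phi] would lie below the complement of [c]. At the level of that meet, [phi] is
   already among the requirements. *)
have H_G phi : G (phi, H phi).
  apply: G_max => c s c0 cH sG.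
  have [b Gb bc0] : exists2 b, G (phi, b) & b `&` c != \bot.
    apply: contrapT => nb; move: c0; rewrite -lex0 => /negP; apply.
    have : H phi <= ~` c.
      apply: H_lub => b Gb; rewrite -disj_leC.
      by apply: contrapT => /negP bc0; apply: nb; exists b.
    by move=> /(le_trans cH); rewrite -disj_leC meetxx lex0.
  apply: A_con bc0 _ => psi; rewrite inE => /predU1P[->|/sG].
    by exists b => //; apply: leIl.
  by move=> [b' Gb' cb']; exists b' => //; apply: le_trans cb'; apply: leIr.
have HE s phi c : ~ con (neg phi :: s) ->
    {in s, forall psi, c <= H psi} -> c <= H phi.
  move=> ncon sH; apply: H_ub; apply: G_entail ncon _ => psi /sH cH.
  by exists (H psi).
exists H; split => //.
  by move=> phi b Gb; apply: H_ub; left.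
(* If [neg phi] were incompatible at a nonzero level [c] disjoint from [H phi], then [phi] would be
   entailed there and [c] would lie below [H phi]. For the other inequality, a nonzero meet of the
   two values would make [phi] and [neg phi] jointly consistent. *)
move=> phi; apply/eqP; rewrite eq_le; apply/andP; split; last first.
  apply: (H_ub); apply: G_max => c s c0 cH sG.
  apply: contrapT => ncon; have cH' := H_ub _ _ (G_entail _ _ _ ncon sG).
  by move: c0; rewrite -lex0 -(meetxx c) lex0 disj_leC (le_trans cH')// lexC.
rewrite -disj_leC; apply: contrapT => /negP c0; apply: (@con_neg phi).
apply: A_con c0 _ => psi; rewrite !inE => /orP[]/eqP->.
  by exists (H phi); [exact: H_G|exact: leIr].
by exists (H (neg phi)); [exact: H_G|exact: leIl].
Qed.

End Extension.

(** * Quotients with representatives, and ultrafilters of a Boolean algebra *)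

Lemma quotient_exists (M : Type) (R : M -> M -> Prop) :
  (forall a, R a a) -> (forall a b, R a b -> R b a) ->
  (forall a b c, R a b -> R b c -> R a c) ->
  exists (N : Type) (q : M -> N) (rep : N -> M),
    (forall x, q (rep x) = x) /\ (forall a b, q a = q b <-> R a b).
Proof.
move=> Rr Rs Rt.
pose N := {A : set M | exists a, A = R a}.
pose q (a : M) : N := exist _ (R a) (ex_intro _ a erefl).
have /choice[rep repP] : forall x : N, exists a, q a = x.
  by move=> [A [a Aa]]; exists a; apply: eq_exist.
exists N, q, rep; split => // a b; split.
  by move=> /(congr1 sval)/= ->; exact: Rr.
move=> Rab; apply: eq_exist; apply/funext => c; apply/propext; split.
  exact/Rt/Rs.
exact: Rt.
Qed.

Section Ultrafilter.
Local Open Scope order_scope.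
Context {d : Order.disp_t} {B : ctbDistrLatticeType d}.

Lemma order_complete_bool : order_complete (bool : porderType _).
Proof.
move=> A; exists `[< A true >]; split=> [x Ax|b ub].
  by case: x Ax => // Ax; rewrite asboolT.
by case: asboolP => [/ub//|_]; case: b ub.
Qed.

(** This is [hom_extension] with target [bool]: a finite list of elements counts as consistent when
    it has a nonzero lower bound, and the only initial requirement is that [b0] be sent to
    [true]. *)
Lemma ultrafilter_exists (b0 : B) : b0 != \bot ->
  exists U : B -> bool, [/\ U b0, forall x, U (~` x) = ~~ U x,
    forall x y, x <= y -> U x -> U y &
    forall x y, U (x `&` y) = U x && U y].
Proof.
move=> b0N0.
pose con (s : seq B) := exists2 c, c != \bot & {in s, forall x, c <= x}.
have [| | | |U [Ub0 UC U_entail]] :=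
  @hom_extension _ bool order_complete_bool B Order.compl con _ _ _
    [set (b0, true)].
- by move=> s s' ss' [c c0 cP]; exists c => // x /ss'/cP.
- move=> s x [c c0 cP]; have [cx|ncx] := boolP (c <= x).
    by left; exists c => // y; rewrite inE => /predU1P[->//|/cP].
  right; exists (c `&` ~` x).
    by move: ncx; rewrite -[x in ~~ (_ <= x)]complK -disj_leC.
  move=> y; rewrite inE => /predU1P[->|/cP cy]; first exact: leIr.
  by rewrite leIxl.
- move=> x [c /negP c0 cP]; apply: c0.
  rewrite -lex0 -(meetxC x) lexI !cP// ?mem_head//.
  by rewrite !inE eqxx orbT.
- move=> c s c0 sP; exists b0 => // x /sP[b [-> _] _] //.
have U_ent (s : seq B) x : {in s, forall y, U y} ->
    (forall c, {in s, forall y, c <= y} -> c <= x) -> U x.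
  move=> Us sx; suff : true <= U x by case: (U x).
  apply: (U_entail s) => [[c /negP c0 cP]|y /Us->//]; apply: c0.
  rewrite -lex0 -(meetxC x) lexI (cP (~` x)) ?mem_head// andbT.
  by apply: sx => y ys; apply: cP; rewrite inE ys orbT.
exists U; split => //.
- by have := Ub0 b0 true erefl; case: (U b0).
- move=> x y xy Ux; apply: (U_ent [:: x]) => [z|c cP].
    by rewrite inE => /eqP ->.
  by apply: le_trans xy; apply: cP; rewrite mem_head.
- move=> x y; apply/idP/andP => [Uxy|[Ux Uy]].
    have Uz z : x `&` y <= z -> U z.
      move=> xyz; apply: (U_ent [:: x `&` y]) => [w|c cP].
        by rewrite inE => /eqP ->.
      by apply: le_trans xyz; apply: cP; rewrite mem_head.
    by split; apply: Uz; rewrite ?leIl ?leIr.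
apply: (U_ent [:: x; y]) => [z|c cP].
  by rewrite !inE => /orP[]/eqP->.
by rewrite lexI !cP ?inE ?eqxx ?orbT.
Qed.

End Ultrafilter.

(** * Łoś's theorem *)

Section BooleanValued.
Local Open Scope order_scope.
Context {L : language} {d : Order.disp_t} {B : ctbDistrLatticeType d}.

(** The formula [Neg (And phi (Neg psi))] is valid, hence has value 1. Through this, two-valued
    semantic arguments yield inequalities in [B]. *)
Lemma bval_le (M : Type) (v : bvstructure L B M) (phi psi : formula L M) :
  (forall (S : structure L) (e : M -> S), sat e phi -> sat e psi) ->
  v phi <= v psi.
Proof.
move=> phipsi; rewrite -[v psi]complK -disj_leC.
have := @bval_valid _ _ _ _ v (Neg (And phi (Neg psi))).
rewrite bval_neg bval_and bval_neg -compl0 => vP.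
apply/eqP/compl_inj/vP => S e /= [sphi]; apply; exact: phipsi.
Qed.

Lemma bval_eqv (M : Type) (v : bvstructure L B M) (phi psi : formula L M) :
  (forall (S : structure L) (e : M -> S), sat e phi <-> sat e psi) ->
  v phi = v psi.
Proof.
by move=> E; apply/eqP; rewrite eq_le; apply/andP; split;
  apply: bval_le => S e /E.
Qed.

Lemma elementary_inj (M N : Type) (v : bvstructure L B M)
  (w : bvstructure L B N) (f : M -> N) : elementary v w f -> injective f.
Proof.
move=> fP a b fab; apply: contrapT => /(@bval_eq _ _ _ _ v).
rewrite fP /= fab bval_valid ?ltxx//.
Qed.

(** A valid formula available even when there are no names; it is true because structures are
    nonempty. *)
Definition verum {V : Type} : formula L V :=
  Ex (Eq (Var None) (Var None)).

Lemma sat_verum (S : structure L) (V : Type) (e : V -> S) : sat e verum.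
Proof. by have [a] := dom_nonempty S; exists a. Qed.

Lemma full_inhabited (M : Type) (v : bvstructure L B M) : full v -> inhabited M.
Proof. by move=> /(_ (fmap Some verum))[a _]. Qed.

(** The structure is [M] modulo equality with value in [U]. Fullness is used twice: to name the
    value of a term by an element, and to pass from an existential formula to an instance of the
    same value. *)
Lemma los (M : Type) (v : bvstructure L B M) (U : B -> bool) :
  full v -> U \top -> (forall x, U (~` x) = ~~ U x) ->
  (forall x y, x <= y -> U x -> U y) ->
  (forall x y, U (x `&` y) = U x && U y) ->
  exists (S : structure L) (q : M -> S),
    forall (W : Type) (s : W -> M) (phi : formula L W),
      sat (q \o s) phi <-> U (v (fmap s phi)).
Proof.
move=> vfull UT UC Ule UI; pose tr phi := U (v phi).
(* Premises are indexed by a finite type since a symbol yields one equation per argument. The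
   induction on a list of premises moves each one into an implication. *)
have tr_ent (I : finType) (h : I -> formula L M) psi : (forall i, tr (h i)) ->
    (forall (S : structure L) (e : M -> S),
      (forall i, sat e (h i)) -> sat e psi) -> tr psi.
  move=> trh.
  suff H (l : seq I) : (forall (S : structure L) (e : M -> S),
      {in l, forall i, sat e (h i)} -> sat e psi) -> tr psi.
    move=> hpsi; apply: (H (enum I)) => S e he; apply: hpsi => i.
    by apply: he; rewrite mem_enum.
  elim: l psi => [|i l IH] psi hpsi.
    by rewrite /tr bval_valid// => S e; apply: hpsi.
  have : tr (Neg (And (h i) (Neg psi))).
    apply: IH => S e he /= [hi]; apply; apply: hpsi => j.
    by rewrite inE => /predU1P[->|/he].
  move=> tr'; apply: (Ule (v (And (h i) (Neg (And (h i) (Neg psi)))))).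
    by apply: bval_le => S e /= [hi]; apply: contra_notP.
  by rewrite bval_and UI; apply/andP; split; [exact: trh|].
have tr_ent1 phi psi : (forall (S : structure L) (e : M -> S),
    sat e phi -> sat e psi) -> tr phi -> tr psi.
  by move=> hpsi; apply: Ule; apply: bval_le.
have tr_ent2 phi psi chi : (forall (S : structure L) (e : M -> S),
    sat e phi -> sat e psi -> sat e chi) -> tr phi -> tr psi -> tr chi.
  move=> hchi tphi tpsi; apply: (tr_ent1 (And phi psi)).
    by move=> S e [/hchi].
  by rewrite /tr bval_and UI; apply/andP.
have [| | |D [q [rep [repK qP]]]] :=
    @quotient_exists M (fun a b => tr (Eq (Var a) (Var b))).
- by move=> a; rewrite /tr bval_valid.
- by move=> a b; apply: tr_ent1 => S e /=.
- by move=> a b c; apply: tr_ent2 => S e /= -> .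
have /choice[wit witP] : forall t : term L M, exists a, tr (Eq t (Var a)).
  move=> t; have [a va] := vfull (Eq (tmap Some t) (Var None)).
  exists a; have : tr (Ex (Eq (tmap Some t) (Var None))).
    rewrite /tr bval_valid// => S e; exists (teval e t) => /=.
    by rewrite teval_tmap; congr teval.
  rewrite /tr va; apply: tr_ent1 => S e; rewrite sat_inst /= teval_tmap.
  by have -> : ext e (e a) \o Some = e by [].
have [m0] := full_inhabited vfull.
pose S := @Structure L D (inhabits (q m0))
  (fun f ts => q (wit (Defs.Fun f (fun i => Var (rep (ts i))))))
  (fun r ts => tr (Rel r (fun i => Var (rep (ts i))))).
have repP a : tr (Eq (Var a) (Var (rep (q a)))) by apply/qP; rewrite repK.
have tevalP (W : Type) (s : W -> M) (t : term L W) :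
    tr (Eq (tmap s t) (Var (rep (teval (q \o s : W -> S) t)))).
  elim: t => [x|f ts IH] /=; first exact: repP.
  set g := Defs.Fun f _; set g' := Defs.Fun f _.
  (* The index [None] carries one premise besides the argument equations: that [g'] equals the
     representative of its chosen value. *)
  apply: (tr_ent [the finType of option 'I_(farity f)] (fun o => if o is Some i
    then Eq (tmap s (ts i)) (Var (rep (teval (q \o s : W -> S) (ts i))))
    else Eq g' (Var (rep (q (wit g')))))) => [[i|]|S' e gP].
  - exact: IH.
  - by apply: tr_ent2 (witP g') (repP (wit g')) => S' e /= -> ->.
  - have /= <- := gP None; congr fint; apply/funext => i.
    exact: (gP (Some i)).
exists S, q => W s phi.
have qrep a : q (rep a) = a by exact: repK.
have qE (Z : Type) (r : Z -> M) a : ext (q \o r) (q a) = q \o ext r a.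
  by apply/funext; case.
elim: phi s => {W} [W t u|W r ts|W p IH|W p IHp p' IHp'|W p IH] s /=.
- have tP := tevalP _ s t; have uP := tevalP _ s u; split => tu.
    by rewrite tu in tP; apply: tr_ent2 tP uP => S' e /= -> ->.
  rewrite -[LHS]repK -[RHS]repK; apply/qP.
  have tu' : tr (Eq (Var (rep (teval (q \o s : W -> S) t))) (tmap s u)).
    by apply: tr_ent2 tP tu => S' e /= <-.
  by apply: tr_ent2 tu' uP => S' e /= ->.
- set r1 := Rel r _; set r2 := Rel r _.
  have rP : (forall i, tr (Eq (tmap s (ts i))
      (Var (rep (teval (q \o s : W -> S) (ts i)))))) by move=> i; exact: tevalP.
  split=> tr12.
    apply: (tr_ent [the finType of option 'I_(rarity r)] (fun o => if o is Some i
      then Eq (tmap s (ts i)) (Var (rep (teval (q \o s : W -> S) (ts i))))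
      else r1)) => [[i|]//|S' e gP].
    have /= := gP None; congr rint; apply/funext => i.
    exact: esym (gP (Some i)).
  apply: (tr_ent [the finType of option 'I_(rarity r)] (fun o => if o is Some i
    then Eq (tmap s (ts i)) (Var (rep (teval (q \o s : W -> S) (ts i))))
    else r2)) => [[i|]//|S' e gP].
  have /= := gP None; congr rint; apply/funext => i.
  exact: (gP (Some i)).
- by rewrite IH bval_neg UC; split => /negP.
- by rewrite IHp IHp' bval_and UI; split => /andP.
- split.
    move=> [a]; rewrite -[a]repK -[fun o => _]/(ext (q \o s) (q (rep a))) qE IH.
    apply: tr_ent1 => S' e; rewrite sat_fmap => sp.
    apply/sat_ex; exists (e (rep a)); rewrite sat_fmap ext_omap.
    by move: sp; congr sat; apply/funext; case.
  have [a ->] := vfull (fmap (omap s) p); rewrite /inst fmap_comp.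
  have -> : odflt a \o omap s = ext s a by apply/funext; case.
  by move=> /IH; rewrite -qE => sp; exists (q a).
Qed.

(** If the value were not 1, an ultrafilter containing its complement would give, by [los], a model
    of [T] in which [phi] fails. *)
Lemma bval_entails (T : set (sentence L)) (M : Type) (v : bvstructure L B M)
  (phi : sentence L) :
  bvmodels v T -> entails T phi -> v (fmap (of_void M) phi) = \top.
Proof.
move=> [vfull vT] Tphi; apply: contrapT => nphi.
have [|U [U1 UC Ule UI]] := @ultrafilter_exists _ _ (~` v (fmap (of_void M) phi)).
  by apply/eqP => /(congr1 Order.compl); rewrite complK compl0.
have UT : U \top by apply: Ule U1; exact: lex1.
have [S [q qP]] := los vfull UT UC Ule UI.
have E : of_void S = q \o of_void M by apply/funext; case.
suff : U (v (fmap (of_void M) phi)) by move: U1; rewrite UC => /negbTE->.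
apply/qP; rewrite -E; apply: Tphi => psi Tpsi.
by rewrite /holds E; apply/qP; rewrite vT.
Qed.

End BooleanValued.

(** * Henkin constants and amalgamation *)

Section Henkin.
Context {L : language}.

(** [Wit phi a] names a witness for [phi] with parameters [a 0], [a 1], and so on. Using templates
    with numbered parameters, the type recurses only through [nat -> henkin W], and by
    [formula_factor] every formula is covered. All levels of the Henkin construction arise at
    once. *)
Inductive henkin (W : Type) : Type :=
| Old of W
| Wit of formula L (option nat) & (nat -> henkin W).

Definition pick_sat (S : structure L) (P : S -> Prop) : S :=
  if pselect (exists x, P x) is left xP then projT1 (cid xP)
  else inhabited_witness (dom_nonempty S).

Lemma pick_satP (S : structure L) (P : S -> Prop) :
  (exists x, P x) -> P (pick_sat P).
Proof. by rewrite /pick_sat; case: pselect => // xP _; exact: projT2. Qed.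

(** Henkin constants are read as Skolem choices in each structure, so the Henkin axioms hold
    automatically. *)
Fixpoint heval (S : structure L) (W : Type) (e : W -> S) (x : henkin W) : S :=
  match x with
  | Old w => e w
  | Wit phi a => pick_sat (fun y => sat (ext (fun n => heval e (a n)) y) phi)
  end.

Lemma henkin_witness (W : Type) (x0 : henkin W)
  (phi : formula L (option (henkin W))) :
  exists c : henkin W, forall (S : structure L) (e : W -> S),
    sat (heval e) (Ex phi) -> sat (heval e) (inst phi c).
Proof.
have [psi [s psiE]] := formula_factor x0 phi.
exists (Wit psi (nth x0 s)) => S e /sat_ex[x]; rewrite sat_inst !psiE => sx.
pose P y := sat (ext (heval e \o nth x0 s) y) psi.
by rewrite -[sat _ _]/(P (pick_sat P)); apply: pick_satP; exists x.
Qed.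

End Henkin.

Section Amalgamation.
Local Open Scope order_scope.
Context {L : language} {d : Order.disp_t} {B : ctbDistrLatticeType d}.
Hypothesis B_complete : order_complete B.

(** The common part [V] is a mere type of names on which both sides give equal values; taking [V] to
    be [void] yields joint embedding. *)
Lemma amalgamation (V M0 M1 : Type) (v0 : bvstructure L B M0)
  (v1 : bvstructure L B M1) (g0 : V -> M0) (g1 : V -> M1) :
  full v0 -> injective g1 ->
  (forall phi : formula L V, v0 (fmap g0 phi) = v1 (fmap g1 phi)) ->
  exists (N : Type) (w : bvstructure L B N) (f0 : M0 -> N) (f1 : M1 -> N),
    [/\ full w, elementary v0 w f0, elementary v1 w f1 &
        forall x, f0 (g0 x) = f1 (g1 x)].
Proof.
move=> v0_full g1_inj v01.
pose C := henkin (L := L) (M0 + M1).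
pose F : eqType := {classic formula L C}.
pose i0 (a : M0) : C := Old (inl a); pose i1 (a : M1) : C := Old (inr a).
pose e01 (S : structure L) (e0 : M0 -> S) (e1 : M1 -> S) (x : M0 + M1) :=
  match x with inl a => e0 a | inr a => e1 a end.
pose con (s : seq F) := exists (S : structure L) (e0 : M0 -> S) (e1 : M1 -> S),
  e1 \o g1 = e0 \o g0 /\
  {in s, forall phi : F, sat (heval (e01 S e0 e1)) (phi : formula L C)}.
(* Lower bounds suffice to preserve values, because the bound for a negation gives the upper
   bound. *)
pose G0 : set (F * B) := fun x =>
  (exists phi, x = (fmap i0 phi : F, v0 phi)) \/
  (exists phi, x = (fmap i1 phi : F, v1 phi)).
have [| | | |H [HG0 Hneg Hent]] :=
  @hom_extension _ B B_complete F Neg con _ _ _ G0.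
- move=> s s' ss' [S [e0 [e1 [E sP]]]]; exists S, e0, e1; split => //.
  by move=> x /ss'/sP.
- move=> s phi [S [e0 [e1 [E sP]]]].
  have [sphi|nphi] := pselect (sat (heval (e01 S e0 e1)) (phi : formula L C)).
    by left; exists S, e0, e1; split => // x; rewrite inE => /predU1P[->|/sP].
  by right; exists S, e0, e1; split => // x; rewrite inE => /predU1P[->|/sP].
- move=> phi [S [e0 [e1 [E sP]]]].
  have : sat (heval (e01 S e0 e1)) (Neg phi) by apply: sP; rewrite !inE eqxx orbT.
  by apply; apply: sP; rewrite mem_head.
- move=> c s c0 sP.
  (* Conjunctions reduce the finite list to one formula on each side, both of value at least [c]. *)
  have [phi0 [phi1 [c0phi c1phi phiP]]] : exists (phi0 : formula L M0)
      (phi1 : formula L M1), [/\ c <= v0 phi0, c <= v1 phi1 &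
      forall (S : structure L) (e0 : M0 -> S) (e1 : M1 -> S),
        sat e0 phi0 -> sat e1 phi1 ->
        {in s, forall phi : F, sat (heval (e01 S e0 e1)) (phi : formula L C)}].
    elim: s sP => [|phi s IH] sP.
      exists verum, verum; split=> //;
        by rewrite bval_valid ?lex1// => S e; exact: sat_verum.
    have [|phi0 [phi1 [c0phi c1phi phiP]]] := IH.
      by move=> psi ps; apply: sP; rewrite inE ps orbT.
    have [b [[chi [phiE bE]]|[chi [phiE bE]]] cb] := sP phi (mem_head _ _).
      exists (And chi phi0), phi1; split => //.
        by rewrite bval_and lexI c0phi -bE cb.
      move=> S e0 e1 [schi s0] s1 psi; rewrite inE => /predU1P[->|].
        by rewrite phiE sat_fmap.
      exact: phiP s0 s1 psi.
    exists phi0, (And chi phi1); split => //.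
      by rewrite bval_and lexI c1phi -bE cb.
    move=> S e0 e1 s0 [schi s1] psi; rewrite inE => /predU1P[->|].
      by rewrite phiE sat_fmap.
    exact: phiP s0 s1 psi.
  have [psi psiP] := ex_closure phi1 g1_inj.
  apply: contrapT => ncon.
  (* Were the list inconsistent, this conjunction would be unsatisfiable and have value 0; yet both
     conjuncts have value at least [c], the second because [v0] and [v1] agree on [psi]. *)
  have : v0 (And phi0 (fmap g0 psi)) <= v0 (Neg verum).
    apply: bval_le => S e0 /sat_and[s0]; rewrite sat_fmap => /psiP[e1 [e1g s1]].
    case: ncon; exists S, e0, e1; split => //; exact: phiP.
  rewrite bval_neg (bval_valid _ (phi := verum)); last first.
    by move=> S e; exact: sat_verum.
  rewrite compl1 bval_and; apply/negP; apply: contra c0; rewrite -lex0.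
  apply: le_trans; rewrite lexI c0phi v01 (le_trans c1phi)//.
  by apply: bval_le => S e s1; rewrite sat_fmap; apply/psiP; exists e.
pose ent (s : seq F) (phi : formula L C) :=
  forall (S : structure L) (e0 : M0 -> S) (e1 : M1 -> S),
  e1 \o g1 = e0 \o g0 ->
  {in s, forall psi : F, sat (heval (e01 S e0 e1)) (psi : formula L C)} ->
  sat (heval (e01 S e0 e1)) phi.
have Hle (s : seq F) (phi : formula L C) c :
    ent s phi -> {in s, forall psi, c <= H psi} -> c <= H phi.
  move=> sphi; apply: Hent => -[S [e0 [e1 [E sP]]]].
  have : sat (heval (e01 S e0 e1)) (Neg phi) by apply: sP; rewrite mem_head.
  by apply; apply: sphi => // psi ps; apply: sP; rewrite inE ps orbT.
have H_le (phi psi : formula L C) : ent [:: phi : F] psi -> H phi <= H psi.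
  by move=> /Hle; apply=> chi; rewrite inE => /eqP->.
have H_top (phi : formula L C) : ent [::] phi -> H phi = \top.
  by move=> /Hle phiP; apply/eqP; rewrite eq_le lex1; apply: phiP.
pose R a b := H (Eq (Var a) (Var b)) = \top.
have R_ent (s : seq F) a b :
    ent s (Eq (Var a) (Var b)) -> {in s, forall psi, H psi = \top} -> R a b.
  move=> sab sT; apply/eqP; rewrite eq_le lex1; apply: Hle sab _ => psi /sT->//.
have R_sym a b : R a b -> R b a.
  move=> Rab; apply: (R_ent [:: Eq (Var a) (Var b) : F]) => [S e0 e1 _ sP|].
    by apply: esym; apply: (sP _ (mem_head _ _)).
  by move=> psi; rewrite inE => /eqP->.
have [| | |N [q [rep [repK qP]]]] := @quotient_exists C R.
- by move=> a; apply: (R_ent [::]) => // S.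
- exact: R_sym.
- move=> a b c Rab Rbc.
  apply: (R_ent [:: (Eq (Var a) (Var b) : F); Eq (Var b) (Var c) : F]).
    move=> S e0 e1 _ sP; have /= ab := sP _ (mem_head _ _).
    rewrite /= ab; apply: (sP (Eq (Var b) (Var c))).
    by rewrite !inE eqxx orbT.
  by move=> psi; rewrite !inE => /orP[]/eqP->.
(* By finite support, finitely many equations of value 1 justify the replacement. *)
have H_congr (X : Type) (s t : X -> C) (phi : formula L X) :
    (forall x, R (s x) (t x)) -> H (fmap s phi) = H (fmap t phi).
  suff le s' t' : (forall x, R (s' x) (t' x)) -> H (fmap s' phi) <= H (fmap t' phi).
    move=> Rst; apply/eqP; rewrite eq_le !le// => x.
    exact/R_sym/Rst.
  move=> Rst; have [l lP] := sat_support phi.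
  pose eqs (x : {classic X}) : F := Eq (Var (s' x)) (Var (t' x)).
  apply: (Hle ((fmap s' phi : F) :: map eqs l)) => [S e0 e1 _ sP|psi].
    have := sP _ (mem_head _ _); rewrite !sat_fmap.
    rewrite -(lP _ (heval (e01 S e0 e1) \o s'))// => x xl.
    by apply: (sP (eqs x)); rewrite in_cons; apply/orP; right; exact: map_f xl.
  rewrite inE => /predU1P[->//|/(@mapP _ F eqs)[x _ ->]].
  by rewrite Rst lex1.
have H_and (phi psi : formula L C) : H (And phi psi) = H phi `&` H psi.
  apply/eqP; rewrite eq_le lexI; apply/andP; split.
    by apply/andP; split; apply: H_le => S e0 e1 _ sP;
      have /sat_and[] := sP _ (mem_head _ _).
  apply: (Hle [:: phi : F; psi : F]) => [S e0 e1 _ sP|chi].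
    by split; apply: sP; rewrite !inE eqxx ?orbT.
  by rewrite !inE => /orP[]/eqP->; [exact: leIl|exact: leIr].
have rep_q a : R (rep (q a)) a by apply/qP; rewrite repK.
have H_ex (phi : formula L (option N)) a :
    H (fmap rep (inst phi a)) <= H (fmap rep (Ex phi)).
  apply: H_le => S e0 e1 _ sP; have := sP _ (mem_head _ _).
  rewrite !sat_fmap => sa; apply/sat_ex.
  exists (heval (e01 S e0 e1) (rep a)).
  by move: sa; congr sat; apply/funext; case.
have H_wit (phi : formula L (option N)) :
    exists a, H (fmap rep (Ex phi)) = H (fmap rep (inst phi a)).
  have [m0] := full_inhabited v0_full.
  have [c cP] := henkin_witness (i0 m0) (fmap (omap rep) phi).
  exists (q c); apply/eqP; rewrite eq_le H_ex andbT.
  have -> : H (fmap rep (inst phi (q c))) = H (inst (fmap (omap rep) phi) c).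
    by rewrite /inst !fmap_comp; apply: H_congr => -[x|]//=; apply/qP.
  by apply: H_le => S e0 e1 _ sP; apply: cP; apply: (sP _ (mem_head _ _)).
have w_ex (phi : formula L (option N)) :
    supremums (range (fun a : N => H (fmap rep (inst phi a))))
      (H (fmap rep (Ex phi))).
  split=> [_ [a _ <-]|b ub]; first exact: H_ex.
  by have [a ->] := H_wit phi; apply: ub; exists a.
have w_valid (phi : formula L N) : valid phi -> H (fmap rep phi) = \top.
  by move=> vphi; apply: H_top => S e0 e1 _ _; rewrite sat_fmap; apply: vphi.
have w_eq (a b : N) : a <> b -> H (fmap rep (Eq (Var a) (Var b))) < \top.
  move=> ab; rewrite lt_neqAle lex1 andbT; apply/eqP => /qP.
  by rewrite !repK.
pose w := BVStructure w_valid (fun phi => Hneg (fmap rep phi))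
  (fun phi psi => H_and (fmap rep phi) (fmap rep psi)) w_ex w_eq.
have H_elem (M : Type) (v : bvstructure L B M) (i : M -> C) :
    (forall phi, v phi <= H (fmap i phi)) -> elementary v w (q \o i).
  move=> vH phi; rewrite /w /= fmap_comp.
  rewrite (H_congr _ (rep \o (q \o i)) i)//; last by move=> x; exact: rep_q.
  apply/eqP; rewrite eq_le vH -leC -Hneg -bval_neg.
  exact: (vH (Neg phi)).
exists N, w, (q \o i0), (q \o i1); split.
- exact: H_wit.
- by apply: H_elem => phi; apply: HG0; left; exists phi.
- by apply: H_elem => phi; apply: HG0; right; exists phi.
- move=> x; apply/qP; apply: (R_ent [::]) => // S e0 e1 E _ /=.
  by have := congr1 (fun f => f x) E.
Qed.

End Amalgamation.

(** * Squares of infinite types *)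

Section Cardinals.

Definition inj_into {T U : Type} (A : set T) (B : set U) (f : T -> U) :=
  (forall x, A x -> B (f x)) /\
  (forall x y, A x -> A y -> f x = f y -> x = y).

(** Applying Zorn to the sets added to [G0] leaves only unions of nonempty chains to check. *)
Lemma Zorn_above (T : Type) (P : set T -> Prop) (G0 : set T) : P G0 ->
  (forall F : set (set T), F !=set0 -> F `<=` P -> total_on F subset ->
    P (\bigcup_(X in F) X)) ->
  exists A, [/\ G0 `<=` A, P A & forall C, A `<=` C -> P C -> C `<=` A].
Proof.
move=> PG0 Pcup.
have [|A [PA Amax]] := @Zorn_bigcup _ [set G | P (G0 `|` G)].
  move=> F FP Ftot.
  have [F0|/set0P F0] := eqVneq F set0.
    by rewrite F0 bigcup_set0 /= setU0.
  rewrite /=; have -> : G0 `|` \bigcup_(X in F) X =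
      \bigcup_(X in [set G0 `|` X | X in F]) X.
    apply/seteqP; split=> [x [G0x|[X FX Xx]]|x [_ [X FX <-] [G0x|Xx]]].
    - have [X FX] := F0; exists (G0 `|` X); last by left.
      by exists X.
    - by exists (G0 `|` X); [exists X|right].
    - by left.
    - by right; exists X.
  apply: Pcup.
  - by have [X FX] := F0; exists (G0 `|` X); exists X.
  - by move=> _ [X /FP PX <-].
  - move=> _ _ [X FX <-] [Y FY <-].
    by have [XY|YX] := Ftot _ _ FX FY; [left|right]; apply: setUS.
exists (G0 `|` A); split; [exact: subsetUl|exact: PA|].
move=> C AC PC x Cx; apply: contrapT => nx.
apply: (Amax C); last first.
  by rewrite /= setUidr// => y G0y; apply: AC; left.
split; first by move=> y Ay; apply: AC; right.
by move=> CA; apply: nx; right; apply: CA.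
Qed.

(** Comparability of cardinals: a maximal graph of a partial injection is total on [A] or covers
    [B], since otherwise one more pair could be added. *)
Lemma inj_into_total (T : Type) (A B : set T) :
  (exists f, inj_into A B f) \/ (exists f : T -> T, inj_into B A f).
Proof.
pose P (G : set (T * T)) :=
  (forall p, G p -> A p.1 /\ B p.2) /\
  (forall p p', G p -> G p' -> p.1 = p'.1 <-> p.2 = p'.2).
have [||G [_ [GAB Ginj] Gmax]] := @Zorn_above _ P set0.
- by split.
- move=> F _ FP Ftot; split; first by move=> p [X /FP[+ _] Xp]; apply.
  move=> p p' [X FX Xp] [Y FY Yp'].
  have [XY|YX] := Ftot _ _ FX FY.
    by have [_] := FP _ FY; apply => //; exact: XY.
  by have [_] := FP _ FX; apply => //; exact: YX.
have [Adom|/existsNP[a /not_implyP[Aa na]]] :=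
    pselect (forall a, A a -> exists b, G (a, b)).
  left; have /choice[f fP] : forall a, exists b, A a -> G (a, b).
    move=> a; have [/Adom[b Gab]|nA] := pselect (A a); first by exists b.
    by exists a.
  exists f; split; first by move=> a /fP/GAB[].
  by move=> a a' /fP Ga /fP Ga' ff; apply/(Ginj _ _ Ga Ga').
have [Bdom|/existsNP[b /not_implyP[Bb nb]]] :=
    pselect (forall b, B b -> exists a, G (a, b)).
  right; have /choice[f fP] : forall b, exists a, B b -> G (a, b).
    move=> b; have [/Bdom[a' Gab]|nB] := pselect (B b); first by exists a'.
    by exists b.
  exists f; split; first by move=> b /fP/GAB[].
  by move=> b b' /fP Gb /fP Gb' ff; apply/(Ginj _ _ Gb Gb').
case: (na); exists b; apply: (Gmax (G `|` [set (a, b)])); last by right.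
  exact: subsetUl.
split; first by move=> p [/GAB//|->].
have nab p : G p -> p.1 <> a /\ p.2 <> b.
  by case: p => x y Gxy; split=> /= E; subst; [case: na; exists y|case: nb; exists x].
move=> p p' [Gp|->] [Gp'|->] //=; first exact: Ginj.
- by have [n1 n2] := nab _ Gp; split.
- by have [n1 n2] := nab _ Gp'; split=> /esym.
Qed.

(** Zorn is applied to graphs of injections from D × D to D, stored as triples, starting from the
    pairing of natural numbers carried over by [i]. If the complement of a maximal D embeds in D, so
    does [T]; otherwise D embeds in its complement and can be enlarged. *)
Lemma square_inj (T : Type) (i : nat -> T) : injective i ->
  exists p : T -> T -> T, forall x y x' y', p x y = p x' y' -> x = x' /\ y = y'.
Proof.
move=> i_inj.
(* The set D is read off the diagonal of the graph. *)
pose fld (G : set (T * T * T)) (x : T) := exists c, G (x, x, c).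
pose P (G : set (T * T * T)) :=
  [/\ forall q q', G q -> G q' -> q.1 = q'.1 <-> q.2 = q'.2,
      forall x y, fld G x -> fld G y -> exists c, G (x, y, c) &
      forall x y c, G (x, y, c) -> [/\ fld G x, fld G y & fld G c]].
pose G0 : set (T * T * T) := fun q =>
  exists m n, q = (i m, i n, i (choice.pickle (m, n))).
have G0_fld n : fld G0 (i n) by exists (i (choice.pickle (n, n))), n, n.
have [||G [GG0 [Ginj Gtot Gfld] Gmax]] := @Zorn_above _ P G0.
- split.
  + move=> _ _ [m [n ->]] [m' [n' ->]] /=; split; first by case=> /i_inj-> /i_inj->.
    by move=> /i_inj/(pcan_inj choice.pickleK)[-> ->].
  + move=> x y [_ [m [_ [-> _ _]]]] [_ [n [_ [-> _ _]]]].
    by exists (i (choice.pickle (m, n))), m, n.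
  + by move=> x y c [m [n [-> -> ->]]]; split; exact: G0_fld.
- move=> F _ FP Ftot.
  have dir X Y : F X -> F Y -> exists Z, [/\ F Z, X `<=` Z & Y `<=` Z].
    by move=> FX FY; have [XY|YX] := Ftot _ _ FX FY; [exists Y|exists X]; split.
  split.
  + move=> q q' [X FX Xq] [Y FY Yq'].
    have [Z [FZ XZ YZ]] := dir _ _ FX FY.
    by have [+ _ _] := FP _ FZ; apply; [exact: XZ|exact: YZ].
  + move=> x y [c [X FX Xx]] [c' [Y FY Yy]].
    have [Z [FZ XZ YZ]] := dir _ _ FX FY; have [_ + _] := FP _ FZ.
    case/(_ x y); [by exists c; exact: XZ|by exists c'; exact: YZ|].
    by move=> c'' Zc; exists c'', Z.
  + move=> x y c [X FX Xc]; have [_ _ /(_ _ _ _ Xc)] := FP _ FX.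
    by move=> [[x' ?] [y' ?] [c' ?]]; split; [exists x'|exists y'|exists c'];
      exists X.
pose D := fld G.
have D_i n : D (i n) by have [c Gc] := G0_fld n; exists c; apply: GG0.
have /choice[g' g'P] : forall q : T * T, exists c, D q.1 -> D q.2 -> G (q, c).
  move=> [x y]; have [Dx|nx] := pselect (D x); last by exists x.
  have [Dy|ny] := pselect (D y); last by exists x.
  by have [c Gc] := Gtot _ _ Dx Dy; exists c.
pose g x y := g' (x, y).
have gD x y : D x -> D y -> D (g x y).
  by move=> Dx Dy; have [] := Gfld _ _ _ (g'P (x, y) Dx Dy).
have g_inj x y x' y' : D x -> D y -> D x' -> D y' -> g x y = g x' y' ->
    x = x' /\ y = y'.
  move=> Dx Dy Dx' Dy' gg.
  by have /Ginj/(_ (g'P (x', y') Dx' Dy'))[_ /(_ gg)[]] := g'P (x, y) Dx Dy.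
(* The tags are [i 0] and [i 1], two distinct points of D. *)
pose tag (b : bool) := i b.
have tag_inj b b' : tag b = tag b' -> b = b' by move=> /i_inj; case: b b' => -[].
have tagD b : D (tag b) by exact: D_i.
have [[psi [psiD psi_inj]]|[phi [phiD phi_inj]]] := inj_into_total (~` D) D.
  (* [h] embeds [T] into D, the tag telling points of D from points of the complement. *)
  have /choice[h hP] : forall x, exists z, D z /\
      ((D x /\ z = g (tag true) x) \/ (~ D x /\ z = g (tag false) (psi x))).
    move=> x; have [Dx|nx] := pselect (D x).
      by exists (g (tag true) x); split; [exact: gD|left].
    exists (g (tag false) (psi x)).
    by split; [apply: gD => //; exact: psiD|right].
  have h_inj x y : h x = h y -> x = y.
    have [Dhx [[Dx hx]|[nx hx]]] := hP x; have [Dhy [[Dy hy]|[ny hy]]] := hP y;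
      rewrite hx hy => /g_inj[]//; try (by move=> /tag_inj);
      try exact: psiD.
    by move=> _; exact: psi_inj.
  exists (fun x y => g (h x) (h y)) => x y x' y' /g_inj[].
  - exact: (hP x).1.
  - exact: (hP y).1.
  - exact: (hP x').1.
  - exact: (hP y').1.
  - by move=> /h_inj-> /h_inj->.
(* The maximal D is strictly extended to D ∪ phi(D), whose points are the
   [dec b x]; the new pairs are sent into phi(D), using tags in D to encode b. *)
have Dt c1 c2 := gD _ _ (tagD c1) (tagD c2).
pose dec (b : bool) x := if b then phi x else x.
have dec_inj b x b' x' : D x -> D x' -> dec b x = dec b' x' -> b = b' /\ x = x'.
  move=> Dx Dx'; case: b b' => -[] /= E; split => //.
  - exact: phi_inj E.
  - by case: (phiD _ Dx); rewrite E.
  - by case: (phiD _ Dx); rewrite E.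
  - by case: (phiD _ Dx'); rewrite -E.
  - by case: (phiD _ Dx'); rewrite -E.
(* The condition [b || b'] leaves out the pairs inside D, which [G] already treats. *)
pose G1 : set (T * T * T) := fun q => exists b x b' x',
  [/\ D x, D x', b || b' & q = (dec b x, dec b' x',
    phi (g (g (tag b) (tag b')) (g x x')))].
have fld1 x : D x -> fld (G `|` G1) (phi x).
  move=> Dx; exists (phi (g (g (tag true) (tag true)) (g x x))).
  by right; exists true, x, true, x.
have fldG x : D x -> fld (G `|` G1) x by move=> [c Gc]; exists c; left.
have fldE x : fld (G `|` G1) x <-> exists b y, D y /\ x = dec b y.
  split; last by move=> [[] [y [Dy ->]]]; [exact: fld1|exact: fldG].
  move=> [c [Gc|[b [y [b' [y' [Dy Dy' _ [-> _ _]]]]]]]]; last by exists b, y.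
  by exists false, x; split => //; exists c.
have G1_sub : G1 `<=` G.
  apply: subset_trans (Gmax (G `|` G1) _ _); [exact: subsetUr|exact: subsetUl|].
  split.
  + have cross q q' : G q -> G1 q' -> q.1 <> q'.1 /\ q.2 <> q'.2.
      move: q => [[x y] c] Gq [b [z [b' [z' [Dz Dz' bb' ->]]]]] /=.
      have [Dx Dy Dc] := Gfld _ _ _ Gq; split.
        move=> [xz yz']; move: bb'; case: (b) (b') xz yz' => -[] //= xz yz' _.
        * by apply: (phiD _ Dz); rewrite -xz.
        * by apply: (phiD _ Dz); rewrite -xz.
        * by apply: (phiD _ Dz'); rewrite -yz'.
      move=> E; have Dw := gD _ _ (gD _ _ (tagD b) (tagD b')) (gD _ _ Dz Dz').
      by apply: (phiD _ Dw); rewrite -E.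
    move=> q q' [Gq|G1q] [Gq'|G1q'].
    * exact: Ginj.
    * by have [] := cross _ _ Gq G1q'.
    * by have [n1 n2] := cross _ _ Gq' G1q; split=> /esym.
    * case: G1q G1q' => b [z [b' [z' [Dz Dz' bb' ->]]]].
      case=> c [y [c' [y' [Dy Dy' cc' ->]]]] /=; split.
        by case=> /dec_inj[]// -> -> /dec_inj[]// -> ->.
      have Dzz := gD _ _ Dz Dz'; have Dyy := gD _ _ Dy Dy'.
      move=> /(phi_inj _ _ (gD _ _ (Dt _ _) Dzz) (gD _ _ (Dt _ _) Dyy)).
      move=> /(g_inj _ _ _ _ (Dt _ _) Dzz (Dt _ _) Dyy)[].
      move=> /(g_inj _ _ _ _ (tagD _) (tagD _) (tagD _) (tagD _))[tt1 tt2].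
      move=> /(g_inj _ _ _ _ Dz Dz' Dy Dy')[]; move: tt1 tt2.
      by move=> /tag_inj-> /tag_inj-> -> ->.
  + move=> x y /fldE[b [x' [Dx' ->]]] /fldE[b' [y' [Dy' ->]]].
    have [|nb] := boolP (b || b').
      by move=> bb'; eexists; right; exists b, x', b', y'; split.
    move: nb; rewrite negb_or => /andP[/negbTE-> /negbTE->] /=.
    by have [c Gc] := Gtot _ _ Dx' Dy'; exists c; left.
  + move=> x y c [Gc|].
      by have [Dx Dy Dc] := Gfld _ _ _ Gc; split; exact: fldG.
    move=> [b [x' [b' [y' [Dx' Dy' bb' [-> -> ->]]]]]]; split.
    * by apply/fldE; exists b, x'.
    * by apply/fldE; exists b', y'.
    * by apply: fld1; apply: (gD); [exact: Dt|exact: gD].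
exfalso; apply: (phiD _ (tagD true)).
have [|Dp _ _] := Gfld (phi (tag true)) (phi (tag true))
  (phi (g (g (tag true) (tag true)) (g (tag true) (tag true)))) => //.
by apply: G1_sub; exists true, (tag true), true, (tag true); split.
Qed.

(** A sequence is coded by its length together with its iterated pairing; the length makes the
    latter decodable. *)
Lemma seq_inj (T : Type) (i : nat -> T) : injective i ->
  exists f : seq T -> T, injective f.
Proof.
move=> i_inj; have [p p_inj] := square_inj i_inj.
pose fold (s : seq T) := foldr p (i 0) s.
exists (fun s => p (i (size s)) (fold s)) => s t /p_inj[/i_inj].
elim: s t => [|x s IH] [|y t]//= [st] /p_inj[-> /(IH _ st) ->//].
Qed.

End Cardinals.

(** * Languages of complete countable theories *)

Section Language.
Context {L : language}.

Section Codes.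
Variables (cf : Defs.fsym L -> nat) (cr : rsym L -> nat).
Hypotheses (cf_inj : injective cf) (cr_inj : injective cr).

Fixpoint tcode (V : Type) (ev : V -> nat) (t : term L V) : GenTree.tree nat :=
  match t with
  | Var x => GenTree.Leaf (ev x)
  | Defs.Fun f ts =>
      GenTree.Node (cf f) [seq tcode ev (ts i) | i <- enum 'I_(farity f)]
  end.

Definition ocode (V : Type) (ev : V -> nat) (o : option V) : nat :=
  if o is Some x then (ev x).+1 else 0.

(** Tags 0 to 3 mark the other constructors, so relation symbols start at 4. The coding [ev] of
    names varies because [Ex] changes the name type; [ocode] reserves 0 for the bound name. *)
Fixpoint fcode (V : Type) (ev : V -> nat) (phi : formula L V) :
    GenTree.tree nat :=
  match phi with
  | Eq t u => GenTree.Node 0 [:: tcode ev t; tcode ev u]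
  | Neg p => GenTree.Node 1 [:: fcode ev p]
  | And p q => GenTree.Node 2 [:: fcode ev p; fcode ev q]
  | Ex p => GenTree.Node 3 [:: fcode (ocode ev) p]
  | Rel r ts =>
      GenTree.Node (cr r).+4 [seq tcode ev (ts i) | i <- enum 'I_(rarity r)]
  end.

Lemma tcode_inj (V : Type) (ev : V -> nat) :
  injective ev -> injective (tcode ev).
Proof.
move=> ev_inj; elim=> [x|f ts IH] [y|g us] //=; first by case=> /ev_inj ->.
case=> /cf_inj fg; case: _ / fg us => us /eq_in_map E.
congr Defs.Fun; apply/funext => i; apply: IH; apply: E.
by rewrite mem_enum.
Qed.

Lemma fcode_inj (V : Type) (ev : V -> nat) :
  injective ev -> injective (fcode ev).
Proof.
move=> + phi; elim: phi ev => {V} [V t u|V r ts|V p IH|V p IHp q IHq|V p IH]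
  ev ev_inj [t' u'|r' ts'|p'|p' q'|p'] //=.
- by case=> /(tcode_inj ev_inj)-> /(tcode_inj ev_inj)->.
- case=> /cr_inj rr; case: _ / rr ts' => ts' /eq_in_map E.
  congr Rel; apply/funext => i; apply: (tcode_inj ev_inj); apply: E.
  by rewrite mem_enum.
- by case=> /(IH _ ev_inj)->.
- by case=> /(IHp _ ev_inj)-> /(IHq _ ev_inj)->.
- case=> /IH-> // [x|] [y|]//= [] /ev_inj-> //.
Qed.

End Codes.

Definition symbol : Type := (Defs.fsym L + rsym L)%type.

(** Separating the interpretation from the domain lets single symbols be reinterpreted on a fixed
    domain. *)
Definition interp (D : Type) : Type :=
  ((forall f : Defs.fsym L, ('I_(farity f) -> D) -> D) *
   (forall r : rsym L, ('I_(rarity r) -> D) -> Prop))%type.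

Definition struct_of (D : Type) (h : inhabited D) (I : interp D) : structure L :=
  Structure h I.1 I.2.

Definition agree_at (D : Type) (I J : interp D) (y : symbol) : Prop :=
  match y with inl f => I.1 f = J.1 f | inr r => I.2 r = J.2 r end.

Lemma teval_symbols (V : Type) (t : term L V) :
  exists s : seq {classic symbol}, forall D (h : inhabited D) (I J : interp D),
    {in s, forall y, agree_at I J y} -> forall e : V -> D,
    teval (S := struct_of h I) e t = teval (S := struct_of h J) e t.
Proof.
elim: t => [v|f ts /choice[s sP]]; first by exists [::].
exists ((inl f : {classic symbol}) :: flatten [seq s i | i <- enum 'I_(farity f)]).
move=> D h I J IJ e /=.
have /= -> := IJ (inl f) (mem_head _ _).
congr (J.1 _ _); apply/funext => i; apply: sP => y ys; apply: IJ.
by rewrite in_cons; apply/orP; right; apply: mem_flatten_enum ys.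
Qed.

Lemma sat_symbols (V : Type) (phi : formula L V) :
  exists s : seq {classic symbol}, forall D (h : inhabited D) (I J : interp D),
    {in s, forall y, agree_at I J y} -> forall e : V -> D,
    sat (S := struct_of h I) e phi = sat (S := struct_of h J) e phi.
Proof.
elim: phi => {V} [V t u|V r ts|V p [s sP]|V p [s sP] q [s' s'P]|V p [s sP]].
- have [s sP] := teval_symbols t; have [s' s'P] := teval_symbols u.
  exists (s ++ s') => D h I J IJ e /=.
  by rewrite (sP D h I J) ?(s'P D h I J)// => x xs; apply: IJ;
    rewrite mem_cat xs ?orbT.
- have /choice[s sP] := fun i => teval_symbols (ts i).
  exists ((inr r : {classic symbol}) :: flatten [seq s i | i <- enum 'I_(rarity r)]).
  move=> D h I J IJ e /=.
  have /= -> := IJ (inr r) (mem_head _ _).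
  congr (J.2 _ _); apply/funext => i; apply: sP => y ys; apply: IJ.
  by rewrite in_cons; apply/orP; right; apply: mem_flatten_enum ys.
- by exists s => D h I J IJ e /=; rewrite (sP D h I J).
- exists (s ++ s') => D h I J IJ e /=.
  by rewrite (sP D h I J) ?(s'P D h I J)// => x xs; apply: IJ;
    rewrite mem_cat xs ?orbT.
- exists s => D h I J IJ e /=; congr ex; apply/funext => a; exact: sP.
Qed.

(* A symbol not occurring in T can be reinterpreted at will in a model of T, so
   completeness forbids it, unless it is a single function symbol. *)
Lemma complete_countable_symbols (T : set (sentence L)) (S : structure L)
  (a b : S) : complete_theory T -> countable T -> is_model T S -> a <> b ->
  (exists cf : Defs.fsym L -> nat, injective cf) /\
  (exists cr : rsym L -> nat, injective cr).
Proof.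
case: S a b => D h fi ri a b [_ Tdec] /countable_injP[tc tc_inj] ST ab.
have /choice[supp suppP] := fun phi : sentence L => sat_symbols phi.
pose K (y : symbol) := exists phi, T phi /\ (y : {classic symbol}) \in supp phi.
have modelP (J : interp D) :
    (forall y, K y -> agree_at (fi, ri) J y) -> is_model T (struct_of h J).
  move=> IJ phi Tphi; rewrite /holds -(suppP phi D h (fi, ri) J).
    exact: ST Tphi.
  by move=> y ys; apply: IJ; exists phi.
(* A symbol is numbered by a sentence of [T] using it and its position in the support of that
   sentence. *)
have /choice[k kP] : forall y, exists n, K y -> exists phi,
    [/\ T phi, (y : {classic symbol}) \in supp phi &
        n = choice.pickle (tc phi, index (y : {classic symbol}) (supp phi))].
  move=> y; have [[phi [Tphi ys]]|nK] := pselect (K y); last by exists 0.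
  exists (choice.pickle (tc phi, index (y : {classic symbol}) (supp phi))).
  by move=> _; exists phi.
have k_inj y y' : K y -> K y' -> k y = k y' -> y = y'.
  move=> /kP[phi [Tphi ys ->]] /kP[phi' [Tphi' ys' ->]].
  move=> /(pcan_inj choice.pickleK)[/tc_inj E].
  have {}E : phi = phi' by apply: E; rewrite inE.
  by rewrite -E in ys' *; exact: index_inj.
split.
  have one f g : ~ K (inl f) -> ~ K (inl g) -> f = g.
    move=> nf ng; apply: contrapT => fg.
    pose J x y : interp D := (fun f0 ts => if pselect (f0 = f) then x
      else if pselect (f0 = g) then y else fi f0 ts, ri).
    have J_model x y : is_model T (struct_of h (J x y)).
      apply: modelP => -[f0|r0]//= Kf0; rewrite /J /=; apply/funext => ts.
      case: pselect => [E|?]; first by case: nf; rewrite -E.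
      by case: pselect => [E|?]; first by case: ng; rewrite -E.
    have Jf x y ts : (J x y).1 f ts = x by rewrite /J /=; case: pselect.
    have Jg x y ts : (J x y).1 g ts = y.
      by rewrite /J /=; case: pselect => [E|?]; [case: fg|case: pselect].
    pose rho : sentence L := Ex (Eq (Defs.Fun f (fun=> Var None))
      (Defs.Fun g (fun=> Var None))).
    have [/(_ _ (J_model a b))|/(_ _ (J_model a a))] := Tdec rho.
      move=> [x Jfg]; apply: ab.
      exact: etrans (esym (Jf a b _)) (etrans Jfg (Jg a b _)).
    by apply; exists a; exact: etrans (Jf a a _) (esym (Jg a a _)).
  exists (fun f => if pselect (K (inl f)) then (k (inl f)).+1 else 0) => f g.
  case: pselect => Kf; case: pselect => Kg //.
    by case=> /(k_inj _ _ Kf Kg)[].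
  by move=> _; apply: one.
have all_r r : K (inr r).
  apply: contrapT => nr.
  pose J (P : Prop) : interp D :=
    (fi, fun r0 ts => if pselect (r0 = r) then P else ri r0 ts).
  have J_model P : is_model T (struct_of h (J P)).
    apply: modelP => -[f0|r0]//= Kr0; rewrite /J /=; apply/funext => ts.
    by case: pselect => [E|?]; first by case: nr; rewrite -E.
  have Jr P ts : (J P).2 r ts = P by rewrite /J /=; case: pselect.
  pose rho : sentence L := Ex (Rel r (fun=> Var None)).
  have [/(_ _ (J_model False))|/(_ _ (J_model True))] := Tdec rho.
    by move=> [x Jx]; rewrite -(Jr False (fun=> x)); exact: Jx.
  by apply; exists a; have := I; rewrite -{1}(Jr True (fun=> a)).
by exists (fun r => k (inr r)) => r r' /(k_inj _ _ (all_r r) (all_r r'))[].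
Qed.

End Language.

(** * Downward Löwenheim–Skolem *)

Section Downward.
Local Open Scope order_scope.
Context {L : language} {d : Order.disp_t} {B : ctbDistrLatticeType d}.

Lemma bval_inst_le (M : Type) (v : bvstructure L B M)
  (phi : formula L (option M)) (a : M) : v (inst phi a) <= v (Ex phi).
Proof. by have [+ _] := bval_ex v phi; apply; exists a. Qed.

Lemma fmap_inst (N M : Type) (i : N -> M) (phi : formula L (option N)) (a : N) :
  fmap i (inst phi a) = inst (fmap (omap i) phi) (i a).
Proof.
by rewrite /inst !fmap_comp; congr fmap; apply/funext; case.
Qed.

(** The Tarski-Vaught test: values are pulled back along [i], and the attained suprema give both the
    clause for [Ex] and fullness. *)
Lemma tarski_vaught (N M : Type) (v : bvstructure L B M) (i : N -> M) :
  injective i ->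
  (forall phi : formula L (option N),
    exists a, v (fmap i (Ex phi)) = v (fmap i (inst phi a))) ->
  exists w : bvstructure L B N, full w /\ elementary w v i.
Proof.
move=> i_inj TV.
have w_ex (phi : formula L (option N)) :
    supremums (range (fun a : N => v (fmap i (inst phi a))))
      (v (fmap i (Ex phi))).
  split=> [_ [a _ <-]|b ub]; first by rewrite fmap_inst; exact: bval_inst_le.
  by have [a ->] := TV phi; apply: ub; exists a.
have w_valid (phi : formula L N) : valid phi -> v (fmap i phi) = \top.
  by move=> vphi; apply: bval_valid => S e; rewrite sat_fmap; exact: vphi.
have w_eq (a b : N) : a <> b -> v (fmap i (Eq (Var a) (Var b))) < \top.
  by move=> ab; apply: bval_eq => /i_inj.
by exists (BVStructure w_valid (fun phi => bval_neg v (fmap i phi))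
  (fun phi psi => bval_and v (fmap i phi) (fmap i psi)) w_ex w_eq).
Qed.

(** Trees are Skolem terms: leaves are generators, a node labelled k + 1 applies the Skolem function
    of the formula with code k, and label 0 gives the default [m0]. Injectivity of [code] makes this
    unambiguous. *)
Lemma skolem_hull (A M : Type) (v : bvstructure L B M)
  (code : formula L (option nat) -> nat) (u : A -> M) :
  full v -> injective code ->
  exists ev : GenTree.tree A -> M, (forall a, ev (GenTree.Leaf a) = u a) /\
    forall phi : formula L (option (GenTree.tree A)), exists t,
      v (Ex (fmap (omap ev) phi)) = v (inst (fmap (omap ev) phi) (ev t)).
Proof.
move=> vfull code_inj; have [m0] := full_inhabited vfull.
have /choice[wit witP] : forall k : nat, exists f : seq M -> M,
    forall psi, k = code psi -> forall s : seq M,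
    v (Ex (fmap (omap (nth m0 s)) psi)) =
    v (inst (fmap (omap (nth m0 s)) psi) (f s)).
  move=> k; have [[psi ->]|nk] := pselect (exists psi, k = code psi).
    have /choice[f fP] := fun s => vfull (fmap (omap (nth m0 s)) psi).
    by exists f => _ /code_inj <-.
  by exists (fun=> m0) => psi kE; case: nk; exists psi.
pose ev := fix ev (t : GenTree.tree A) : M :=
  match t with
  | GenTree.Leaf a => u a
  | GenTree.Node k ts => if k is k'.+1 then wit k' (map ev ts) else m0
  end.
exists ev; split => // phi; pose t0 : GenTree.tree A := GenTree.Node 0 [::].
have [psi [s psiP]] := formula_factor t0 phi.
(* Beyond the end of [s] both sides are [m0], the value of [t0]. *)
have nthE : nth m0 (map ev s) = ev \o nth t0 s.
  apply/funext => n /=; have [ns|ns] := ltnP n (size s).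
    by rewrite (nth_map t0).
  by rewrite !nth_default// size_map.
have satE (S : structure L) (e : M -> S) x :
    sat (ext e x) (fmap (omap ev) phi) =
    sat (ext e x) (fmap (omap (nth m0 (map ev s))) psi).
  by rewrite !sat_fmap !ext_omap psiP nthE.
exists (GenTree.Node (code psi).+1 s).
have -> : v (Ex (fmap (omap ev) phi)) =
    v (Ex (fmap (omap (nth m0 (map ev s))) psi)).
  by apply: bval_eqv => S e; split=> /sat_ex[x sx]; apply/sat_ex; exists x;
    rewrite ?satE// -satE.
rewrite (witP _ psi erefl); apply: bval_eqv => S e.
by rewrite !sat_inst satE.
Qed.

Lemma card_le_inj (T U : Type) (f : T -> U) :
  injective f -> [set: T] #<= [set: U].
Proof.
move=> f_inj.
have fE : (f @` [set: T]) #= [set: T] by apply: inj_card_eq; exact: in2W.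
by rewrite -(card_le_eql fE); apply: subset_card_le.
Qed.

(** Trees encode as sequences over [nat + A], an infinite type, which [seq_inj] embeds back into
    it. *)
Lemma card_tree_le (A : Type) : [set: GenTree.tree A] #<= [set: A + nat].
Proof.
have [f f_inj] := @seq_inj (nat + A)%type inl
  (fun m n E => let: erefl := E in erefl).
pose swap (x : nat + A) : A + nat :=
  match x with inl n => inr n | inr a => inl a end.
apply: (@card_le_inj _ _ (swap \o f \o @GenTree.encode A)) => s t /= E.
apply: (pcan_inj (@GenTree.codeK A)); apply: f_inj.
by case: (f _) (f _) E => [n|a] [m|b] //= [->].
Qed.

Lemma downward (U : Type) (M : set U) (v : bvstructure L B M) (X : set U)
  (code : formula L (option nat) -> nat) :
  full v -> injective code -> X `<=` M ->
  exists (N : set U) (w : bvstructure L B N),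
    [/\ full w, elementary_sub w v, X `<=` N & N #<= [set: X + nat]]%classic.
Proof.
move=> vfull code_inj XM.
have [ev [ev_leaf evP]] := skolem_hull (inclusion XM) vfull code_inj.
pose N : set U := range (fun t => val (ev t)).
have NM : N `<=` M by move=> _ [t _ <-]; apply: set_mem; exact: valP.
have XN : X `<=` N.
  move=> x Xx; exists (GenTree.Leaf (exist _ x (mem_set Xx))) => //.
  by rewrite ev_leaf.
(* Chosen trees turn formulas over [N] into formulas over trees, to which [evP] applies. *)
have /choice[k kP] : forall a : N, exists t, inclusion NM a = ev t.
  move=> [x xN]; have [t _ tx] := set_mem xN.
  by exists t; apply: val_inj.
have i_inj : injective (inclusion NM).
  by move=> a b /(congr1 val) /= /val_inj.
have [|w [wfull welem]] := @tarski_vaught _ _ v _ i_inj.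
  move=> phi; have [t tP] := evP (fmap (omap k) phi).
  have tN : val (ev t) \in N by apply: mem_set; exists t.
  exists (exist _ (val (ev t)) tN); rewrite fmap_inst.
  have -> : inclusion NM (exist _ (val (ev t)) tN) = ev t by apply: val_inj.
  have iE : inclusion NM = ev \o k by apply/funext => a; rewrite kP.
  by move: tP; rewrite fmap_comp compose_omap -iE.
exists N, w; split => //; first by exists NM.
by apply: card_le_trans (card_tree_le X); exact: card_image_le.
Qed.

End Downward.

(** * Löwenheim-Skolem, joint embedding and amalgamation for full models of [T] *)

Theorem theorem3p5 (L : language) (T : set (sentence L))
    (T_complete : complete_theory T) (T_countable : countable T)
    (d : Order.disp_t) (B : ctbDistrLatticeType d)
    (B_complete : order_complete B) :
  (forall (U : Type) (M : set U) (v : bvstructure L B M) (X : set U),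
     bvmodels v T -> X `<=` M ->
     exists (N : set U) (w : bvstructure L B N),
       [/\ full w, elementary_sub w v, X `<=` N & N #<= [set: X + nat]])
  /\
  (forall (M0 M1 : Type) (v0 : bvstructure L B M0) (v1 : bvstructure L B M1),
     bvmodels v0 T -> bvmodels v1 T ->
     exists (N : Type) (w : bvstructure L B N) (f0 : M0 -> N) (f1 : M1 -> N),
       [/\ bvmodels w T, elementary v0 w f0 & elementary v1 w f1])
  /\
  (forall (U : Type) (M M0 M1 : set U) (v : bvstructure L B M)
     (v0 : bvstructure L B M0) (v1 : bvstructure L B M1),
     bvmodels v T -> bvmodels v0 T -> bvmodels v1 T ->
     elementary_sub v v0 -> elementary_sub v v1 ->
     exists (N : Type) (w : bvstructure L B N) (f0 : M0 -> N) (f1 : M1 -> N),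
       [/\ bvmodels w T, elementary v0 w f0, elementary v1 w f1 &
           forall (MM0 : M `<=` M0) (MM1 : M `<=` M1) (a : M),
             f0 (inclusion MM0 a) = f1 (inclusion MM1 a)]).
Proof.
split; [|split].
- move=> U M v X [vfull vT] XM; have [[S ST] Tdec] := T_complete.
  (* If [T] refutes [all_eq], it has a model with two distinct elements and the language is
     countable; otherwise [M] is a singleton and serves as [N]. *)
  pose all_eq : sentence L :=
    Neg (Ex (Ex (Neg (Eq (Var (Some None)) (Var None))))).
  have [T_eq|/(_ S ST) nall] := Tdec all_eq; last first.
    have [a [b ab]] : exists a b : S, a <> b.
      apply: contrapT => nab; apply: nall => -[a [b /= ab]].
      by apply: nab; exists a, b.
    have [[cf cf_inj] [cr cr_inj]] :=
      complete_countable_symbols T_complete T_countable ST ab.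
    have code_inj := fcode_inj cf_inj cr_inj
      (ev := ocode id) (fun x y E => ltac:(by case: x y E => [x|] [y|] //= [->])).
    apply: (@downward _ _ _ _ _ v X (choice.pickle \o fcode cf cr (ocode id))) => //.
    by apply: inj_comp code_inj; exact: (pcan_inj choice.pickleK).
  have M_eq (a b : M) : a = b.
    apply: contrapT => /(@bval_eq _ _ _ _ v); apply/negP.
    rewrite lt_neqAle lex1 andbT negbK eq_le lex1 /=.
    rewrite -(bval_entails (conj vfull vT) T_eq); apply: bval_le => S' e /= nn.
    by apply: contrapT => nab; apply: nn; exists (e a), (e b).
  exists M, v; split => //.
    have MM : M `<=` M by [].
    exists MM; have -> : inclusion MM = id by apply/funext => a; exact: val_inj.
    by move=> phi; rewrite fmap_id.
  have [m0] := full_inhabited vfull.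
  have -> : M = range (fun _ : X + nat => val m0).
    apply/seteqP; split=> [x Mx|_ [_ _ <-]].
      exists (inr 0) => //.
      exact: (congr1 val (M_eq m0 (exist _ x (mem_set Mx)))).
    by apply: set_mem; exact: valP.
  exact: card_image_le.
- move=> M0 M1 v0 v1 v0T v1T.
  have [|||N [w [f0 [f1 [wfull el0 el1 _]]]]] :=
    @amalgamation L d B B_complete void M0 M1 v0 v1 (of_void M0) (of_void M1).
  + exact: v0T.1.
  + by case.
  + move=> phi.
    (* By completeness, a sentence or its negation has value 1 on both sides. *)
    have [/bval_entails Tphi|/bval_entails Tphi] := T_complete.2 phi.
      by rewrite !Tphi.
    apply: (inv_inj (@complK _ B)).
    rewrite -!bval_neg.
    exact: etrans (Tphi _ _ _ _ v0T) (esym (Tphi _ _ _ _ v1T)).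
  exists N, w, f0, f1; split => //; split => // phi Tphi.
  have <- : f0 \o of_void M0 = of_void N by apply/funext; case.
  by rewrite -fmap_comp -el0; exact: v0T.2.
- move=> U M M0 M1 v v0 v1 vT v0T v1T [MM0 e0] [MM1 e1].
  have [|||N [w [f0 [f1 [wfull el0 el1 f01]]]]] :=
    @amalgamation L d B B_complete M M0 M1 v0 v1
      (inclusion MM0) (inclusion MM1).
  + exact: v0T.1.
  + exact: elementary_inj e1.
  + by move=> phi; rewrite -e0 -e1.
  exists N, w, f0, f1; split => //.
    split => // phi Tphi.
    have <- : f0 \o of_void M0 = of_void N by apply/funext; case.
    by rewrite -fmap_comp -el0; exact: v0T.2.
  (* The inclusion maps do not depend on the proofs of inclusion. *)
  by move=> MM0' MM1' a; rewrite (Prop_irrelevance MM0' MM0)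
    (Prop_irrelevance MM1' MM1).
Qed.
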